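(* Let $\alpha>0$ and $\tau>0$ satisfy $\alpha\tau<1$, let $x_a\in\mathbb R^n$ be a local minimum of the potential $V:\mathbb R^n\to\mathbb R$, and let $\sigma:\mathbb R^n\to\mathbb R^{n\times m}$ be the diffusion tensor. The trajectories of the approximating SDE $$(1-\alpha\tau)\,\mathrm d\mathcal X(t) = -\nabla V(\mathcal X(t))\,\mathrm dt-\alpha\left(\mathcal X(t)-x_a\right)\mathrm dt+\sigma(\mathcal X(t))\,\mathrm dW(t),\qquad t\ge 0,$$ coincide, after the time rescaling $s=t/(1-\alpha\tau)$, with the trajectories of the rescaled approximating SDE $$\mathrm d\widetilde{\mathcal X}(s) = -\nabla V(\widetilde{\mathcal X}(s))\,\mathrm ds-\alpha\left(\widetilde{\mathcal X}(s)-x_a\right)\mathrm ds+\widetilde\sigma(\widetilde{\mathcal X}(s))\,\mathrm d\widetilde W(s),\qquad s\ge 0,$$ where $\widetilde\sigma(x):=\sigma(x)/\sqrt{1-\alpha\tau}$ and $\widetilde W$ is a standard $m$-dimensional Wiener process. That is, for a process $\mathcal X(t)$, $t\ge0$, and $\widetilde{\mathcal X}(s):=\mathcal X((1-\alpha\tau)s)$, $s\geq 0$: $\mathcal X$ solves the first equation for some standard $m$-dimensional Wiener process $W$ if and only if $\widetilde{\mathcal X}$ solves the second equation for some standard $m$-dimensional Wiener process $\widetilde W$.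
   Context: Here $m\ge n$. The functions $V$ and $\sigma$ are assumed smooth enough to ensure the regularity (well-posedness) of the SDEs involved. $V$ has a finite number of local minima, one of which is $x_a$. A standard $m$-dimensional Wiener process has mutually independent components, each a standard scalar Wiener process. SDEs are understood in the Itô sense: a solution is a continuous process adapted to a filtration with respect to which the driving process is a Wiener process, and which satisfies the corresponding integral equation. *)

(* Defs.v *)
From mathcomp Require Import all_boot all_order all_algebra.
From mathcomp Require Import all_classical all_reals all_analysis.

Set Implicit Arguments.
Unset Strict Implicit.
Unset Printing Implicit Defensive.

Import Order.TTheory GRing.Theory Num.Theory.
Import numFieldNormedType.Exports.

Local Open Scope classical_set_scope.
Local Open Scope ring_scope.

(* Elements of R^n are row vectors.  Processes are indexed by R, but only the
   indices t >= 0 are ever constrained. *)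

Section potential.
Context {R : realType} {n : nat}.

Definition gradient (V : 'rV[R]_n -> R) (x : 'rV[R]_n) : 'rV[R]_n :=
  \row_i 'D_(delta_mx 0 i) V x.

Definition continuously_differentiable (V : 'rV[R]_n -> R) : Prop :=
  (forall x, differentiable V x) /\ continuous (gradient V).

Definition local_minimum (V : 'rV[R]_n -> R) (x : 'rV[R]_n) : Prop :=
  \forall y \near x, V x <= V y.

End potential.

Section stochastic_processes.
Context {d : measure_display} {Omega : measurableType d} {R : realType}.
Variable P : probability Omega R.

Definition sigma_measurable (G : set (set Omega)) (Y : Omega -> R) : Prop :=
  forall A : set (measurableTypeR R), measurable A -> G (Y @^-1` A).

Definition generated_sigma (I : Type) (D : set I) (Y : I -> Omega -> R) :
    set (set Omega) :=
  <<s \bigcup_(i in D)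
        preimage_set_system setT (Y i) (@measurable _ (measurableTypeR R)) >>.

Definition independent (G H : set (set Omega)) : Prop :=
  forall A B, G A -> H B -> P (A `&` B) = (P A * P B)%E.

Definition mutually_independent (I : finType) (G : I -> set (set Omega)) :
    Prop :=
  forall (J : {set I}) (A : I -> set Omega),
    (forall i, i \in J -> G i (A i)) ->
    P (\bigcap_(i in [set` J]) A i) = (\prod_(i in J) P (A i))%E.

Definition cvg_in_probability (Y : nat -> Omega -> \bar R) : Prop :=
  forall e : R, 0 < e ->
    P [set w | (e%:E <= `|Y k w|)%E] @[k --> \oo] --> 0%E.

Definition continuous_paths (T : topologicalType) (X : R -> Omega -> T) :
    Prop :=
  forall w, {within `[0, +oo[, continuous (fun t => X t w)}.

Record filtration (F : R -> set (set Omega)) : Prop := {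
  filtration_sigma : forall t, 0 <= t -> sigma_algebra setT (F t);
  filtration_sub : forall t, 0 <= t -> F t `<=` measurable;
  filtration_mono : forall s t, 0 <= s -> s <= t -> F s `<=` F t }.

Definition adapted (F : R -> set (set Omega)) (H : R -> Omega -> R) : Prop :=
  forall t, 0 <= t -> sigma_measurable (F t) (H t).

(* The Gaussian clause is restricted to s < t because the library's
   [normal_prob] with standard deviation 0 is not the Dirac mass. *)
Record scalar_wiener (B : R -> Omega -> R) : Prop := {
  wiener_rv : adapted (fun=> measurable) B;
  wiener_start : {ae P, forall w, B 0 w = 0};
  wiener_continuous : continuous_paths B;
  wiener_gaussian : forall s t, 0 <= s -> s < t ->
    forall A : set (measurableTypeR R), measurable A ->
      P ((fun w => B t w - B s w) @^-1` A)
      = normal_prob 0 (Num.sqrt (t - s)) A;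
  wiener_indep_incr : forall s t, 0 <= s -> s <= t ->
    independent (generated_sigma `[0, s] B)
                (generated_sigma [set: unit] (fun _ w => B t w - B s w)) }.

Definition standard_wiener (m : nat) (W : R -> Omega -> 'rV[R]_m) : Prop :=
  (forall j, scalar_wiener (fun t w => W t w 0 j)) /\
  mutually_independent
    (fun j : 'I_m => generated_sigma `[0, +oo[ (fun t w => W t w 0 j)).

Record wiener_wrt (F : R -> set (set Omega)) (m : nat)
    (W : R -> Omega -> 'rV[R]_m) : Prop := {
  wiener_wrt_standard : standard_wiener W;
  wiener_wrt_adapted : forall j, adapted F (fun t w => W t w 0 j);
  wiener_wrt_indep : forall s t, 0 <= s -> s <= t ->
    independent (F s)
      (generated_sigma [set: 'I_m] (fun j w => W t w 0 j - W s w 0 j)) }.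

(* The simple integrand \sum_(i < size) coef i * 1_(time i, time i.+1]. *)
Record simple_integrand := SimpleIntegrand {
  simple_size : nat;
  simple_time : nat -> R;
  simple_coef : nat -> Omega -> R }.

Record simple_adapted (F : R -> set (set Omega)) (S : simple_integrand) :
    Prop := {
  simple_time_ge0 : 0 <= simple_time S 0;
  simple_time_mono : forall i, simple_time S i <= simple_time S i.+1;
  simple_coef_bounded : exists C : R,
    forall i w, (i < simple_size S)%N -> `|simple_coef S i w| <= C;
  simple_coef_meas : forall i, (i < simple_size S)%N ->
    sigma_measurable (F (simple_time S i)) (simple_coef S i) }.

Definition simple_eval (S : simple_integrand) (t : R) (w : Omega) : R :=
  \sum_(i < simple_size S)
    simple_coef S i w * \1_(`]simple_time S i, simple_time S i.+1]) t.

Definition simple_integral (S : simple_integrand) (B : R -> Omega -> R)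
    (t : R) (w : Omega) : R :=
  \sum_(i < simple_size S)
    simple_coef S i w * (B (Num.min t (simple_time S i.+1)) w
                         - B (Num.min t (simple_time S i)) w).

Record ito_integrand (F : R -> set (set Omega)) (H : R -> Omega -> R) :
    Prop := {
  ito_integrand_meas : measurable_fun
    ((`[0, +oo[%classic : set (measurableTypeR R)) `*` [set: Omega])
    (fun p : measurableTypeR R * Omega => H p.1 p.2 : measurableTypeR R);
  ito_integrand_adapted : adapted F H;
  ito_integrand_L2 : forall T, 0 <= T -> {ae P, forall w,
    (\int[lebesgue_measure]_(s in `[0%R, T]) ((H s w) ^+ 2)%:E < +oo)%E} }.

(* [ito_integral F B H I] : I is a continuous version of the Ito integral
   \int_0^t H dB, t >= 0, where B is a scalar Wiener process with respect to F.
   The integral is the limit in probability of the integrals of any sequence of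
   simple integrands approximating H in L^2([0, T]) in probability for every T;
   the limit does not depend on the sequence. *)
Definition ito_integral (F : R -> set (set Omega)) (B H I : R -> Omega -> R) :
    Prop :=
  [/\ ito_integrand F H,
      adapted (fun=> measurable) I,
      continuous_paths I &
      exists S : nat -> simple_integrand,
      [/\ forall k, simple_adapted F (S k),
          forall T, 0 <= T -> cvg_in_probability (fun k w =>
            (\int[lebesgue_measure]_(s in `[0%R, T])
               ((simple_eval (S k) s w - H s w) ^+ 2)%:E)%E) &
          forall t, 0 <= t -> cvg_in_probability (fun k w =>
            (simple_integral (S k) B t w - I t w)%:E)]].

(* c dX(t) = b(X(t)) dt + sigma(X(t)) dW(t), t >= 0. *)
Definition sde_solution (n m : nat) (c : R) (b : 'rV[R]_n -> 'rV[R]_n)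
    (sigma : 'rV[R]_n -> 'M[R]_(n, m)) (F : R -> set (set Omega))
    (W : R -> Omega -> 'rV[R]_m) (X : R -> Omega -> 'rV[R]_n) : Prop :=
  [/\ continuous_paths X,
      forall i, adapted F (fun t w => X t w 0 i) &
      exists I : 'I_n -> 'I_m -> R -> Omega -> R,
        (forall i j, ito_integral F (fun t w => W t w 0 j)
                       (fun t w => sigma (X t w) i j) (I i j)) /\
        {ae P, forall w, forall t i, 0 <= t ->
          lebesgue_measure.-integrable `[0, t]
            (fun s => (b (X s w) 0 i)%:E) /\
          c * (X t w 0 i - X 0 w 0 i) =
            \int[lebesgue_measure]_(s in `[0, t]) (b (X s w) 0 i)
            + \sum_(j < m) I i j t w}].

Definition solves_sde_for_some_wiener (n m : nat) (c : R)
    (b : 'rV[R]_n -> 'rV[R]_n) (sigma : 'rV[R]_n -> 'M[R]_(n, m))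
    (X : R -> Omega -> 'rV[R]_n) : Prop :=
  exists (F : R -> set (set Omega)) (W : R -> Omega -> 'rV[R]_m),
    [/\ filtration F, wiener_wrt F W & sde_solution c b sigma F W X].

End stochastic_processes.

(* Main.v *)
Require Import Defs.
From mathcomp Require Import all_boot all_order all_algebra.
From mathcomp Require Import all_classical all_reals all_analysis.
From mathcomp Require Import ring measurable_realfun.

Set Implicit Arguments.
Unset Strict Implicit.
Unset Printing Implicit Defensive.

Import Order.TTheory GRing.Theory Num.Theory.
Import numFieldNormedType.Exports.

Local Open Scope classical_set_scope.
Local Open Scope ring_scope.

(** Both directions are instances of one statement, proved for every speed
[c > 0]: if [X] solves [c0 dX = b(X) dt + sigma(X) dW] then [Y s = X (c s)]
solves [(c0 / c) dY = b(Y) ds + (sigma(Y) / sqrt c) dW'], where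
[W' s = W (c s) / sqrt c] ([solves_sde_time_change]).  Taking
[c = 1 - alpha tau] and [c0 = c] gives the direct implication.  For the
converse the speed is [1 / c] and [c0 = 1]: composing the two changes of time
gives back [X], and the two factors in front of [sigma] cancel.

To see that [Y] solves the new equation, write the old one at time [c s] and
divide by [c].  The drift integral over [[0, c s]] is [c] times the integral of
[b(Y)] over [[0, s]], so its factor disappears.  It remains that the Ito
integral of [sigma(Y) / sqrt c] with respect to [W'] at time [s] is [1 / c]
times that of [sigma(X)] with respect to [W] at time [c s]: one factor
[1 / sqrt c] comes from the integrand and one from the Wiener process.  This is
read off from simple integrands ([simple_integral_time_change]) and passes to
the limit because the squared error in L^2([0, T]) of the rescaled simple
integrands is [1 / c^2] times the original squared error in L^2([0, c T])
([integral_sqr_time_change]).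

That [W'] is a Wiener process for the filtration [F (c s)] is Brownian scaling
([wiener_wrt_time_change]).  The law of an increment follows from the behaviour
of centred normal laws under dilations ([normal_prob_scale]).  All the
independence clauses follow from monotonicity: the sigma-algebras generated by
the rescaled process are contained in sigma-algebras generated by the original
one.

The analytic input is the substitution [x = c y] in Lebesgue integrals of
measurable functions ([integral_scale]), which rests on the uniqueness of
Lebesgue measure among measures with its values on intervals. *)

(** * Linear changes of variable *)

Section linear_change_of_variable.
Context {R : realType}.
Variable c : R.
Hypothesis c_gt0 : 0 < c.
Local Notation mu := (@lebesgue_measure R).
Implicit Types (D : set (measurableTypeR R)) (f : measurableTypeR R -> \bar R).

Local Notation scale :=
  (fun x : measurableTypeR R => c * x : measurableTypeR R).

Lemma measurable_scale : measurable_fun setT scale.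
Proof. exact: mulrl_measurable. Qed.

Lemma measurable_preimage_scale D : measurable D -> measurable (scale @^-1` D).
Proof.
by move=> mD; rewrite -[X in measurable X]setTI; exact: measurable_scale.
Qed.

Lemma preimage_scale_itv (a b : itv_bound R) :
  scale @^-1` [set` Interval (map_itv_bound (fun x => c * x) a)
                             (map_itv_bound (fun x => c * x) b)]
  = [set` Interval a b].
Proof.
apply/funext => x; apply/propext; rewrite /=.
by case: a => [[] a|[]]; case: b => [[] b|[]];
  rewrite /= !in_itv/= ?(ler_pM2l c_gt0, ltr_pM2l c_gt0).
Qed.

(** The right-hand side is [c] times the image of Lebesgue measure under the
dilation; it gives an interval its length, and this determines it. *)
Lemma lebesgue_measure_scale D : measurable D ->
  mu D = (c%:E * mu (scale @^-1` D))%E.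
Proof.
move=> mD.
have c0 : 0 <= c by exact: ltW.
apply: (@lebesgue_measure_unique R
  (mscale (NngNum c0) (pushforward mu scale))) => //.
  exact: measurable_scale.
move=> mscl _ [[a b]] _ <-.
rewrite -[RHS]/(c%:E * mu (scale @^-1` [set` `]a, b]]))%E.
have -> : (scale @^-1` [set` `]a, b]]) = [set` `](c^-1 * a), (c^-1 * b)]].
  rewrite -(preimage_scale_itv (BRight (c^-1 * a)) (BRight (c^-1 * b)))/=.
  by rewrite !mulVKf// gt_eqF.
rewrite !lebesgue_measure_itv/= !lte_fin ltr_pM2l ?invr_gt0//.
case: ifPn => _; last by rewrite mule0.
by rewrite -!EFinB -EFinM -mulrBr mulVKf// gt_eqF.
Qed.

(** Read from right to left: the integral over the preimage is an integral
against the image of Lebesgue measure under the dilation, and that image is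
[c^-1] times Lebesgue measure. *)
Lemma ge0_integral_scale D f : measurable D -> measurable_fun D f ->
    (forall x, D x -> 0 <= f x)%E ->
  (\int[mu]_(x in D) f x
   = c%:E * \int[mu]_(x in scale @^-1` D) f (c * x)%R)%E.
Proof.
move=> mD mf f0.
have c0 : 0 <= c^-1 by rewrite invr_ge0 ltW.
have -> : (\int[mu]_(x in scale @^-1` D) f (c * x)%R
           = c^-1%:E * \int[mu]_(x in D) f x)%E.
  transitivity (\int[pushforward mu scale]_(x in D) f x)%E.
    rewrite ge0_integral_pushforward//.
      exact: measurable_scale.
    by move=> x /[!inE]; exact: f0.
  rewrite (@eq_measure_integral _ _ _ D (mscale (NngNum c0) mu)).
  - exact: ge0_integral_mscale.
  - exact: measurable_scale.
  move=> msc A mA _; rewrite -[RHS]/(c^-1%:E * mu A)%E.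
  rewrite [in RHS]lebesgue_measure_scale//.
  by rewrite muleA -EFinM mulVf ?gt_eqF// mul1e.
by rewrite muleA -EFinM mulfV ?gt_eqF// mul1e.
Qed.

Lemma measurable_fun_scale d (T : measurableType d) D
    (g : measurableTypeR R -> T) :
  measurable D -> measurable_fun D g ->
  measurable_fun (scale @^-1` D) (fun x => g (c * x)).
Proof.
move=> mD mg; apply: (measurable_comp mD _ mg) => //.
by move=> _ [x Dx <-].
Qed.

Lemma integrable_scale D f : measurable D -> mu.-integrable D f ->
  mu.-integrable (scale @^-1` D) (fun x => f (c * x)).
Proof.
move=> mD /integrableP[mf fi]; apply/integrableP; split.
  exact: measurable_fun_scale.
move: fi; rewrite ge0_integral_scale//; last first.
  exact: (measurableT_comp _ mf).
rewrite -[X in (_ < X)%E -> _](@gt0_muley _ c%:E) ?lte_fin//.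
by rewrite lte_pmul2l// lte_fin.
Qed.

Lemma integral_scale D f : measurable D -> mu.-integrable D f ->
  (\int[mu]_(x in D) f x
   = c%:E * \int[mu]_(x in scale @^-1` D) f (c * x)%R)%E.
Proof.
move=> mD fi; have mf := measurable_int _ fi.
have fci := integrable_scale mD fi.
rewrite integralE [in RHS]integralE.
rewrite muleBr//; last first.
  apply: fin_num_adde_defl.
  rewrite fin_numN; apply: integrable_fin_num.
    exact: measurable_preimage_scale.
  by apply: integrable_funeneg => //; exact: measurable_preimage_scale.
congr (_ - _)%E.
- rewrite (@ge0_integral_scale D f^\+%E)//; last exact: measurable_funepos.
  by congr (_ * _)%E; apply: eq_integral => x _; rewrite !funeposE.
- rewrite (@ge0_integral_scale D f^\-%E)//; last exact: measurable_funeneg.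
  by congr (_ * _)%E; apply: eq_integral => x _; rewrite !funenegE.
Qed.

Lemma Rintegral_scale D (g : R -> R) :
    measurable D -> mu.-integrable D (EFin \o g) ->
  \int[mu]_(x in D) g x = c * \int[mu]_(x in scale @^-1` D) g (c * x).
Proof.
move=> mD gi; rewrite /Rintegral (integral_scale mD gi)/= fineM//.
apply: integrable_fin_num; first exact: measurable_preimage_scale.
exact: (integrable_scale mD gi).
Qed.

End linear_change_of_variable.

(** If [N] is centred normal with standard deviation [s] then [a N] is centred
normal with standard deviation [a s]: the exponents of the two densities agree
after the substitution [x = a y], and the Jacobian [a] cancels against the ratio
of the normalizing constants. *)
Lemma normal_prob_scale (R : realType) (a s : R)
    (A : set (measurableTypeR R)) : 0 < a -> 0 < s -> measurable A ->
  normal_prob 0 (a * s) A = normal_prob 0 s ((fun x => a * x) @^-1` A).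
Proof.
move=> a0 s0 mA; rewrite /normal_prob.
rewrite (ge0_integral_scale a0)//; last 2 first.
- apply: measurable_funTS; apply/measurable_EFinP.
  exact: measurable_normal_pdf.
- by move=> x _; rewrite lee_fin normal_pdf_ge0.
have mfun_pdf : measurable_fun setT
    (fun x : measurableTypeR R => (normal_pdf 0 (a * s) (a * x))%:E).
  apply/measurable_EFinP; apply: (measurableT_comp (measurable_normal_pdf _ _)).
  exact: measurable_scale.
rewrite -ge0_integralZl//; first last.
- by rewrite lee_fin ltW.
- by move=> x _; rewrite lee_fin normal_pdf_ge0.
- exact: measurable_funTS.
- exact: measurable_preimage_scale.
apply: eq_integral => x _; rewrite -EFinM !normal_pdfE ?gt_eqF ?mulr_gt0//.
have -> : normal_fun 0 (a * s) (a * x) = normal_fun 0 s x.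
  by congr expR; rewrite !subr0; field; rewrite ?gt_eqF.
rewrite mulrA; congr (_ * _)%:E; rewrite /normal_peak.
rewrite exprMn -mulrA -mulrnAr sqrtrM ?sqr_ge0// sqrtr_sqr gtr0_norm//.
by rewrite invfM mulVKf// gt_eqF.
Qed.

(** * Brownian scaling *)

Section generated_sigma_algebras.
Context {d : measure_display} {Omega : measurableType d} {R : realType}.
Variable P : probability Omega R.
Implicit Types G H : set (set Omega).

Lemma sigma_measurable_scale G (Y : Omega -> R) (a : R) :
  sigma_measurable G Y -> sigma_measurable G (fun w => a * Y w).
Proof. by move=> GY A mA; exact: (GY _ (measurable_preimage_scale a mA)). Qed.

Lemma generated_sigma_measurable (I : Type) (D : set I) (Y : I -> Omega -> R)
    (i : I) : D i -> sigma_measurable (generated_sigma D Y) (Y i).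
Proof.
move=> Di A mA; apply: sub_sigma_algebra; exists i => //.
by exists A => //; rewrite setTI.
Qed.

(** All inclusions between sigma-algebras of the original and of the rescaled
process are obtained from this criterion. *)
Lemma generated_sigma_sub (I J : Type) (D : set I) (D' : set J)
    (Y : I -> Omega -> R) (Z : J -> Omega -> R) :
  (forall j, D' j -> sigma_measurable (generated_sigma D Y) (Z j)) ->
  generated_sigma D' Z `<=` generated_sigma D Y.
Proof.
move=> mZ; apply: smallest_sub; first exact: smallest_sigma_algebra.
by move=> _ [j D'j [A mA <-]]; rewrite setTI; exact: mZ.
Qed.

Lemma independent_sub G G' H H' : G' `<=` G -> H' `<=` H ->
  independent P G H -> independent P G' H'.
Proof. by move=> GG' HH' indep A B /GG' GA /HH' HB; exact: indep. Qed.

Lemma mutually_independent_sub (I : finType) (G G' : I -> set (set Omega)) :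
  (forall i, G' i `<=` G i) -> mutually_independent P G ->
  mutually_independent P G'.
Proof. by move=> GG' indep J A G'A; apply: indep => i /G'A /GG'. Qed.

End generated_sigma_algebras.

Section time_change.
Context {d : measure_display} {Omega : measurableType d} {R : realType}.
Variable P : probability Omega R.
Variable c : R.
Hypothesis c_gt0 : 0 < c.

Let c_ge0 : 0 <= c. Proof. exact: ltW. Qed.

Let le_scale (s t : R) : s <= t -> c * s <= c * t.
Proof. by rewrite ler_pM2l. Qed.

Let ge0_scale (t : R) : 0 <= t -> 0 <= c * t.
Proof. exact: mulr_ge0. Qed.

Lemma filtration_time_change (F : R -> set (set Omega)) :
  filtration F -> filtration (fun s => F (c * s)).
Proof.
move=> [Fsigma Fsub Fmono]; split=> [t t0|t t0|s t s0 st].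
- exact: Fsigma (ge0_scale t0).
- exact: Fsub (ge0_scale t0).
- exact: Fmono (ge0_scale s0) (le_scale st).
Qed.

Lemma adapted_time_change (F : R -> set (set Omega)) (H : R -> Omega -> R)
    (a : R) :
  adapted F H -> adapted (fun s => F (c * s)) (fun s w => a * H (c * s) w).
Proof.
by move=> FH t t0; apply: sigma_measurable_scale; apply: FH; exact: ge0_scale.
Qed.

Lemma continuous_paths_time_change (T : topologicalType)
    (X : R -> Omega -> T) :
  continuous_paths X -> continuous_paths (fun s w => X (c * s) w).
Proof.
move=> cX w; apply/subspace_continuousP => t /=.
rewrite in_itv/= andbT => t0.
have /subspace_continuousP/(_ (c * t)) := cX w.
rewrite /= in_itv/= andbT => /(_ (ge0_scale t0)) Xct.
apply: (cvg_comp (fun s => c * s) (X^~ w) _ Xct).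
move=> A nA.
have cvgc : (fun s : R => c * s) @ t --> c * t by exact: mulrl_continuous.
change (\near t, `[0, +oo[%classic t -> A (c * t)).
have : \near t, `[0, +oo[%classic (c * t) -> A (c * t) by exact: (cvgc _ nA).
apply: filterS => s /= cA; rewrite in_itv/= andbT => s0.
by apply: cA; rewrite in_itv/= andbT; exact: ge0_scale.
Qed.

Lemma continuous_paths_scale (I : R -> Omega -> R) (a : R) :
  continuous_paths I -> continuous_paths (fun s w => a * I s w).
Proof.
by move=> cI w t; apply: cvgM; [exact: cvg_cst|exact: cI].
Qed.

Lemma coord_time_change (m : nat) (W : R -> Omega -> 'rV[R]_m) (a : R)
    (j : 'I_m) :
  (fun t w => (a *: W (c * t) w) 0 j) = (fun t w => a * W (c * t) w 0 j).
Proof. by apply/funext => t; apply/funext => w; rewrite mxE. Qed.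

(** Brownian scaling: the increment over [[s, t]] of the new process is
[(sqrt c)^-1] times an increment of variance [c (t - s)], hence has variance
[t - s]. *)
Lemma scalar_wiener_time_change (B : R -> Omega -> R) :
  scalar_wiener P B ->
  scalar_wiener P (fun s w => (Num.sqrt c)^-1 * B (c * s) w).
Proof.
have sqrtc_gt0 : 0 < (Num.sqrt c)^-1 by rewrite invr_gt0 sqrtr_gt0.
have incrE s t : (fun w => (Num.sqrt c)^-1 * B (c * t) w
                           - (Num.sqrt c)^-1 * B (c * s) w)
               = (fun w => (Num.sqrt c)^-1 * (B (c * t) w - B (c * s) w)).
  by apply/funext => w; rewrite mulrBr.
move=> [Bm B0 Bc Bg Bi]; split.
- exact: (adapted_time_change (F := fun=> measurable)).
- by apply: filterS B0 => w B0w; rewrite mulr0 B0w mulr0.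
- exact/continuous_paths_scale/continuous_paths_time_change.
- move=> s t s0 st A mA; rewrite incrE.
  have cst : c * s < c * t by rewrite ltr_pM2l.
  have sdE : Num.sqrt (t - s) = (Num.sqrt c)^-1 * Num.sqrt (c * t - c * s).
    by rewrite -mulrBr (sqrtrM _ c_ge0) mulKf// gt_eqF// sqrtr_gt0.
  rewrite sdE (normal_prob_scale _ _ mA)//; last by rewrite sqrtr_gt0 subr_gt0.
  exact: (Bg _ _ (ge0_scale s0) cst _ (measurable_preimage_scale _ mA)).
- move=> s t s0 st.
  apply: independent_sub (Bi _ _ (ge0_scale s0) (le_scale st)).
  + apply: generated_sigma_sub => r /= /[!in_itv]/= /andP[r0 rs].
    apply: sigma_measurable_scale; apply: generated_sigma_measurable.
    by rewrite /= in_itv/= ge0_scale// le_scale.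
  + apply: generated_sigma_sub => -[] _.
    rewrite incrE; apply: sigma_measurable_scale.
    exact: (@generated_sigma_measurable _ _ _ _ _
      (fun _ w => B (c * t) w - B (c * s) w) tt).
Qed.

Lemma standard_wiener_time_change (m : nat) (W : R -> Omega -> 'rV[R]_m) :
  standard_wiener P W ->
  standard_wiener P (fun s w => (Num.sqrt c)^-1 *: W (c * s) w).
Proof.
move=> [Wj Wi]; split=> [j|].
  by rewrite coord_time_change; exact: scalar_wiener_time_change (Wj j).
apply: mutually_independent_sub Wi => j; rewrite coord_time_change.
apply: generated_sigma_sub => t /= /[!in_itv]/= /[!andbT] t0.
apply: sigma_measurable_scale.
apply: (@generated_sigma_measurable _ _ _ _ _ (fun t w => W t w 0 j)).
by rewrite /= in_itv/= ge0_scale.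
Qed.

Lemma wiener_wrt_time_change (F : R -> set (set Omega)) (m : nat)
    (W : R -> Omega -> 'rV[R]_m) :
  wiener_wrt P F W ->
  wiener_wrt P (fun s => F (c * s))
    (fun s w => (Num.sqrt c)^-1 *: W (c * s) w).
Proof.
move=> [Ws Wa Wi]; split.
- exact: standard_wiener_time_change.
- move=> j; rewrite coord_time_change.
  exact: (adapted_time_change (H := fun t w => W t w 0 j)).
- move=> s t s0 st.
  apply: independent_sub (Wi _ _ (ge0_scale s0) (le_scale st)) => //.
  apply: generated_sigma_sub => j _.
  have -> : (fun w => ((Num.sqrt c)^-1 *: W (c * t) w) 0 j
                      - ((Num.sqrt c)^-1 *: W (c * s) w) 0 j)
          = (fun w => (Num.sqrt c)^-1 * (W (c * t) w 0 j - W (c * s) w 0 j)).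
    by apply/funext => w; rewrite !mxE mulrBr.
  apply: sigma_measurable_scale.
  exact: (@generated_sigma_measurable _ _ _ _ _
    (fun j w => W (c * t) w 0 j - W (c * s) w 0 j)).
Qed.

(** * Change of time in stochastic integrals and equations *)

Lemma cvg_in_probability_scale (a : R) (Y : nat -> Omega -> \bar R) : 0 < a ->
  cvg_in_probability P Y ->
  cvg_in_probability P (fun k w => a%:E * Y k w)%E.
Proof.
move=> a0 Ycvg e e0.
have -> : (fun k => P [set w | (e%:E <= `|a%:E * Y k w|)%E])
        = (fun k => P [set w | ((a^-1 * e)%:E <= `|Y k w|)%E]).
  apply/funext => k; congr (P _); apply/funext => w; apply/propext => /=.
  rewrite abseM gee0_abs; last by rewrite lee_fin ltW.
  by rewrite EFinM lee_pdivrMl.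
by apply: Ycvg; rewrite mulr_gt0// invr_gt0.
Qed.

Lemma preimage_scale_segment (t : R) :
  (fun s => c * s) @^-1` `[0, c * t]%classic = `[0, t]%classic.
Proof.
by have := preimage_scale_itv c_gt0 (BLeft 0) (BRight t); rewrite /= mulr0.
Qed.

(** The factor on the coefficients makes this approximate the rescaled integrand
[(sqrt c)^-1 H (c s)] when [S] approximates [H]. *)
Definition simple_time_change (S : @simple_integrand _ Omega R) :=
  SimpleIntegrand (simple_size S) (fun i => c^-1 * simple_time S i)
    (fun i w => (Num.sqrt c)^-1 * simple_coef S i w).

Lemma simple_eval_time_change S t w :
  simple_eval (simple_time_change S) t w
  = (Num.sqrt c)^-1 * simple_eval S (c * t) w.
Proof.
rewrite /simple_eval /= mulr_sumr; apply: eq_bigr => i _.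
rewrite -mulrA; congr (_ * (_ * _)).
rewrite !indicE; congr (nat_of_bool _)%:R.
by apply/idP/idP; rewrite !inE /= !in_itv/= ltr_pdivrMl// ler_pdivlMl.
Qed.

(** One factor [(sqrt c)^-1] comes from the coefficients and one from the
integrator. *)
Lemma simple_integral_time_change S (B : R -> Omega -> R) t w :
  simple_integral (simple_time_change S)
    (fun s w => (Num.sqrt c)^-1 * B (c * s) w) t w
  = c^-1 * simple_integral S B (c * t) w.
Proof.
have cinv : c^-1 = (Num.sqrt c)^-1 * (Num.sqrt c)^-1.
  by rewrite -invfM -expr2 sqr_sqrtr.
have minE x : c * Num.min t (c^-1 * x) = Num.min (c * t) x.
  by rewrite minr_pMr// mulVKf// gt_eqF.
rewrite /simple_integral /= mulr_sumr; apply: eq_bigr => i _.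
by rewrite !minE -mulrBr mulrACA -cinv.
Qed.

Lemma simple_adapted_time_change F S :
  simple_adapted F S ->
  simple_adapted (fun s => F (c * s)) (simple_time_change S).
Proof.
move=> [t0 tm [C bC] Sm]; split => /=.
- by rewrite mulr_ge0// invr_ge0.
- by move=> i; rewrite ler_pM2l// invr_gt0.
- exists ((Num.sqrt c)^-1 * C) => i w iS.
  by rewrite normrM ger0_norm ?invr_ge0// ler_wpM2l ?invr_ge0//; exact: bC.
- move=> i iS; rewrite mulVKf ?gt_eqF//.
  by apply: sigma_measurable_scale; exact: Sm.
Qed.

Lemma measurable_simple_eval (S : simple_integrand) (w : Omega) :
  measurable_fun setT (fun t : measurableTypeR R => simple_eval S t w).
Proof.
rewrite /simple_eval; apply: measurable_sum => i.
by apply: measurable_funM => //; exact: measurable_indic.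
Qed.

(** Of the factor [c^-2], one [c^-1] is the square of [(sqrt c)^-1] and the
other is the Jacobian of the substitution. *)
Lemma integral_sqr_time_change (T : R) (g : measurableTypeR R -> R) :
  measurable_fun (`[0, c * T]%classic : set (measurableTypeR R)) g ->
  (\int[lebesgue_measure]_(s in `[0%R, T])
      (((Num.sqrt c)^-1 * g (c * s)) ^+ 2)%:E
   = (c ^- 2)%:E * \int[lebesgue_measure]_(s in `[0%R, (c * T)%R])
      ((g s) ^+ 2)%:E)%E.
Proof.
move=> mg.
have mg2 : measurable_fun (`[0, c * T]%classic : set (measurableTypeR R))
    (fun s => ((g s) ^+ 2)%:E).
  by apply/measurable_EFinP; exact: measurable_funX.
rewrite [in RHS](ge0_integral_scale c_gt0)//; last first.
  by move=> x _; rewrite lee_fin sqr_ge0.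
have := measurable_fun_scale (c := c) (measurable_itv _) mg2.
rewrite !preimage_scale_segment => mgc2.
rewrite muleA -EFinM (_ : c ^- 2 * c = c^-1); last first.
  by rewrite expr2 invfM mulfVK// gt_eqF.
rewrite -ge0_integralZl//; last 2 first.
- by move=> x _; rewrite lee_fin sqr_ge0.
- by rewrite lee_fin invr_ge0.
apply: eq_integral => s _.
by rewrite -EFinM exprMn exprVn sqr_sqrtr.
Qed.

Lemma measurable_time_section (H : R -> Omega -> R) (T : R) (w : Omega) :
  measurable_fun
    ((`[0, +oo[%classic : set (measurableTypeR R)) `*` [set: Omega])
    (fun p : measurableTypeR R * Omega => H p.1 p.2 : measurableTypeR R) ->
  measurable_fun (`[0, T]%classic : set (measurableTypeR R))
    (fun s : measurableTypeR R => H s w).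
Proof.
move=> mH.
apply: (measurable_comp (F := (`[0, +oo[%classic : set (measurableTypeR R))
  `*` [set: Omega]) _ _ mH (g := fun s : measurableTypeR R => (s, w))).
- exact: measurableX.
- move=> _ [s /= sT <-]; split => //=; move: sT.
  by rewrite !in_itv/= => /andP[->].
- by apply: measurable_funTS; exact: measurable_pair2.
Qed.

Lemma ito_integrand_time_change F H : ito_integrand P F H ->
  ito_integrand P (fun s => F (c * s))
    (fun s w => (Num.sqrt c)^-1 * H (c * s) w).
Proof.
move=> [Hm Ha HL2]; split.
- apply: measurable_funM => //.
  apply: (measurable_comp (F := (`[0, +oo[%classic : set (measurableTypeR R))
    `*` [set: Omega]) _ _ Hm
    (g := fun p : measurableTypeR R * Omega => (c * p.1, p.2))).
  + exact: measurableX.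
  + move=> _ [[s w] /= [s0 _] <-]; split => //=; move: s0.
    by rewrite !in_itv/= !andbT; exact: ge0_scale.
  + apply: measurable_funTS; apply: measurable_fun_pair => //.
    exact: (measurableT_comp (measurable_scale c)).
- exact: adapted_time_change.
- move=> T T0; apply: filterS (HL2 _ (ge0_scale T0)) => w Hw.
  rewrite (integral_sqr_time_change (g := fun s => H s w)); last first.
    exact: measurable_time_section.
  by rewrite lte_mul_pinfty// lee_fin invr_ge0 sqr_ge0.
Qed.

(** The rescaled simple integrands are an approximating sequence for the
rescaled integrand: their L^2 errors on [[0, T]] and their integrals at time
[t] are constant multiples of those of the original sequence on [[0, c T]] and
at time [c t]. *)
Lemma ito_integral_time_change F B H I : ito_integral P F B H I ->
  ito_integral P (fun s => F (c * s))
    (fun s w => (Num.sqrt c)^-1 * B (c * s) w)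
    (fun s w => (Num.sqrt c)^-1 * H (c * s) w)
    (fun s w => c^-1 * I (c * s) w).
Proof.
move=> [Hi Im Ic [S [Sa SL2 SI]]]; split.
- exact: ito_integrand_time_change.
- exact: (adapted_time_change (F := fun=> measurable)).
- exact/continuous_paths_scale/continuous_paths_time_change.
exists (fun k => simple_time_change (S k)); split.
- by move=> k; exact: simple_adapted_time_change.
- move=> T T0.
  have c2 : 0 < c ^- 2 by rewrite invr_gt0 exprn_gt0.
  have := cvg_in_probability_scale c2 (SL2 _ (ge0_scale T0)).
  congr (cvg_in_probability P _); apply/funext => k; apply/funext => w.
  rewrite -(integral_sqr_time_change
    (g := fun s => simple_eval (S k) s w - H s w)).
    by apply: eq_integral => s _; rewrite simple_eval_time_change mulrBr.
  apply: measurable_funB.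
    by apply: measurable_funTS; exact: measurable_simple_eval.
  by apply: measurable_time_section; exact: ito_integrand_meas Hi.
- move=> t t0.
  have c1 : 0 < c^-1 by rewrite invr_gt0.
  have := cvg_in_probability_scale c1 (SI _ (ge0_scale t0)).
  congr (cvg_in_probability P _); apply/funext => k; apply/funext => w.
  by rewrite simple_integral_time_change -EFinM mulrBr.
Qed.

(** The old equation at time [c t], divided by [c]. *)
Lemma sde_solution_time_change (n m : nat) (c0 : R)
    (b : 'rV[R]_n -> 'rV[R]_n) (sigma : 'rV[R]_n -> 'M[R]_(n, m))
    (F : R -> set (set Omega)) (W : R -> Omega -> 'rV[R]_m)
    (X : R -> Omega -> 'rV[R]_n) :
  sde_solution P c0 b sigma F W X ->
  sde_solution P (c^-1 * c0) b (fun x => (Num.sqrt c)^-1 *: sigma x)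
    (fun s => F (c * s)) (fun s w => (Num.sqrt c)^-1 *: W (c * s) w)
    (fun s w => X (c * s) w).
Proof.
move=> [Xc Xa [I [Iito Xeq]]]; split.
- exact: continuous_paths_time_change.
- by move=> i t t0; exact: (Xa i _ (ge0_scale t0)).
exists (fun i j s w => c^-1 * I i j (c * s) w); split=> [i j|].
  rewrite coord_time_change.
  have -> : (fun t w => ((Num.sqrt c)^-1 *: sigma (X (c * t) w)) i j)
          = (fun t w => (Num.sqrt c)^-1 * sigma (X (c * t) w) i j).
    by apply/funext => t; apply/funext => w; rewrite mxE.
  exact: ito_integral_time_change (Iito i j).
apply: filterS Xeq => w Xw t i t0.
have [bi eqX] := Xw _ i (ge0_scale t0).
split.
  by have := integrable_scale c_gt0 _ bi; rewrite preimage_scale_segment; exact.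
rewrite mulr0 -mulrA eqX (Rintegral_scale c_gt0)// preimage_scale_segment.
by rewrite mulrDr mulKf ?gt_eqF// mulr_sumr.
Qed.

Lemma solves_sde_time_change (n m : nat) (c0 : R)
    (b : 'rV[R]_n -> 'rV[R]_n) (sigma : 'rV[R]_n -> 'M[R]_(n, m))
    (X : R -> Omega -> 'rV[R]_n) :
  solves_sde_for_some_wiener P c0 b sigma X ->
  solves_sde_for_some_wiener P (c^-1 * c0) b
    (fun x => (Num.sqrt c)^-1 *: sigma x) (fun s w => X (c * s) w).
Proof.
move=> [F [W [Ff FW XW]]].
exists (fun s => F (c * s)), (fun s w => (Num.sqrt c)^-1 *: W (c * s) w).
split; [exact: filtration_time_change|exact: wiener_wrt_time_change|].
exact: sde_solution_time_change.
Qed.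

End time_change.

(** * The rescaled equation *)

Theorem theorem1 (R : realType) (n m : nat) (hnm : (n <= m)%N)
    (alpha tau : R) (halpha : 0 < alpha) (htau : 0 < tau)
    (halphatau : alpha * tau < 1)
    (V : 'rV[R]_n -> R) (sigma : 'rV[R]_n -> 'M[R]_(n, m))
    (hV : continuously_differentiable V) (hsigma : continuous sigma)
    (hVmin : finite_set [set x | local_minimum V x])
    (xa : 'rV[R]_n) (hxa : local_minimum V xa)
    (d : measure_display) (Omega : measurableType d)
    (P : probability Omega R) (X : R -> Omega -> 'rV[R]_n) :
  solves_sde_for_some_wiener P (1 - alpha * tau)
    (fun x => - gradient V x - alpha *: (x - xa)) sigma X
  <->
  solves_sde_for_some_wiener P 1
    (fun x => - gradient V x - alpha *: (x - xa))
    (fun x => (Num.sqrt (1 - alpha * tau))^-1 *: sigma x)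
    (fun s w => X ((1 - alpha * tau) * s) w).
Proof.
have c_gt0 : 0 < 1 - alpha * tau by rewrite subr_gt0.
move: (1 - alpha * tau) c_gt0 => c c_gt0.
have c_neq0 : c != 0 by rewrite gt_eqF.
split=> [/(solves_sde_time_change c_gt0)|]; first by rewrite mulVf.
have cV_gt0 : 0 < c^-1 by rewrite invr_gt0.
(* Running the rescaled solution at speed [1 / c] recovers [X]. *)
move=> /(solves_sde_time_change cV_gt0); rewrite invrK mulr1.
have -> : (fun s w => X (c * (c^-1 * s)) w) = X.
  by apply/funext => s; rewrite mulVKf.
have -> // :
  (fun x => (Num.sqrt c^-1)^-1 *: ((Num.sqrt c)^-1 *: sigma x)) = sigma.
apply/funext => x; rewrite scalerA sqrtrV ?ltW// invrK mulfV ?scale1r//.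
by rewrite gt_eqF// sqrtr_gt0.
Qed.
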